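(* Let $f(x)\in\mathbb{Z}[x]$ be a univariate polynomial of degree $d$ with coefficients of magnitude bounded by $C\in\mathbb{N}$, and let $p$ be a prime. There is $k_0=O(d^2(\log C+\log d))$ such that for all $k\ge k_0$ the number $N_k(f)$ has the closed form $$N_k(f)=\sum_{i=1}^{n}p^{\,k-\lceil (k-\nu_i)/e_i\rceil}.$$ Moreover, if $f$ has non-zero discriminant, then $N_k(f)$ is constant (independent of $k$) for all $k\ge k_0$.
   Context: $N_k(f)$ is the number of $a\in\mathbb{Z}/\langle p^k\rangle$ with $f(a)\equiv 0\bmod p^k$. $\mathbb{Z}_p$ is the ring of $p$-adic integers and $v_p$ the $p$-adic valuation. $\alpha_1,\ldots,\alpha_n$ ($n\ge 0$) are the distinct roots of $f$ in $\mathbb{Z}_p$, $e_i$ is the multiplicity of $\alpha_i$ as a root of $f$, $f_i(x):=f(x)/(x-\alpha_i)^{e_i}\in\mathbb{Z}_p[x]$, and $\nu_i:=v_p(f_i(\alpha_i))$. An empty sum (case $n=0$) is $0$. *)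

(* Defs.v *)
From HB Require Import structures.
From mathcomp Require Import all_boot all_order all_algebra.
From mathcomp Require Import boolp classical_sets reals exp.
From mathcomp Require Import polyorder.

Set Implicit Arguments.
Unset Strict Implicit.
Unset Printing Implicit Defensive.

Import Order.TTheory GRing.Theory Num.Theory.
Local Open Scope ring_scope.

(* An element of Z_p, the inverse limit of the rings Z/p^k, is a sequence
   whose k-th term is the residue modulo p^k in [0, p^k[ of the next one. *)
Definition padic_compatible (p : nat) (x : nat -> int) : Prop :=
  forall k, x k = (x k.+1 %% (p ^ k)%N)%Z.

(* The primality proof is a parameter of the type so that the canonical
   structures below (nontrivial ring, integral domain) can rely on it. *)
Record padic_int (p : nat) (p_pr : prime p) := PadicInt {
  padic_coord : nat -> int;
  _ : `[< padic_compatible p padic_coord >] }.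

HB.instance Definition _ p (p_pr : prime p) :=
  [isSub for @padic_coord p p_pr].
HB.instance Definition _ p (p_pr : prime p) :=
  [Choice of padic_int p_pr by <:].

Section PadicRing.
Variables (p : nat) (p_pr : prime p).
Local Notation Zp := (padic_int p_pr).
Implicit Types x y z : Zp.

Local Notation q k := ((p ^ k)%N%:Z).

Lemma padic_intP x y : padic_coord x =1 padic_coord y -> x = y.
Proof. by move=> xy; apply/val_inj/funext. Qed.

Lemma padic_coordS x k : padic_coord x k = (padic_coord x k.+1 %% q k)%Z.
Proof. by case: x => x /= /asboolP. Qed.

Lemma padic_coord_mod x k : (padic_coord x k %% q k)%Z = padic_coord x k.
Proof. by rewrite padic_coordS modz_mod. Qed.

Lemma modz_expS (m : int) k : ((m %% q k.+1)%Z %% q k)%Z = (m %% q k)%Z.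
Proof.
by rewrite {2}(divz_eq m (q k.+1)) expnS PoszM mulrA modzMDl.
Qed.

Lemma padic_coord_le x j k : (j <= k)%N ->
  padic_coord x j = (padic_coord x k %% q j)%Z.
Proof.
move=> /subnKC <-; elim: (k - j)%N => [|i IHi].
  by rewrite addn0 padic_coord_mod.
rewrite IHi addnS [in LHS]padic_coordS.
by rewrite expnD PoszM {2}(divz_eq (padic_coord x (j + i).+1) (q j * q i))
  mulrA mulrAC modzMDl.
Qed.

Lemma padic_of_subproof (u : nat -> int) :
    (forall k, (u k = u k.+1 %[mod q k])%Z) ->
  `[< padic_compatible p (fun k => (u k %% q k)%Z) >].
Proof. by move=> u_comp; apply/asboolP => k; rewrite modz_expS u_comp. Qed.

Definition padic_of u u_comp : Zp := PadicInt p_pr (@padic_of_subproof u u_comp).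

Fact padic_const_comp (m : int) k : (m = m %[mod q k])%Z. Proof. by []. Qed.

Fact padic_opp_comp x k :
  (- padic_coord x k = - padic_coord x k.+1 %[mod q k])%Z.
Proof. by rewrite padic_coordS modzNm. Qed.

Fact padic_add_comp x y k :
  (padic_coord x k + padic_coord y k
     = padic_coord x k.+1 + padic_coord y k.+1 %[mod q k])%Z.
Proof. by rewrite (padic_coordS x) (padic_coordS y) modzDm. Qed.

Fact padic_mul_comp x y k :
  (padic_coord x k * padic_coord y k
     = padic_coord x k.+1 * padic_coord y k.+1 %[mod q k])%Z.
Proof. by rewrite (padic_coordS x) (padic_coordS y) modzMm. Qed.

Definition padic_zero : Zp := padic_of (padic_const_comp 0).
Definition padic_one : Zp := padic_of (padic_const_comp 1).
Definition padic_opp x : Zp := padic_of (padic_opp_comp x).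
Definition padic_add x y : Zp := padic_of (padic_add_comp x y).
Definition padic_mul x y : Zp := padic_of (padic_mul_comp x y).

Fact padic_addA : associative padic_add.
Proof. by move=> x y z; apply: padic_intP => k /=; rewrite modzDml modzDmr addrA. Qed.

Fact padic_addC : commutative padic_add.
Proof. by move=> x y; apply: padic_intP => k /=; rewrite addrC. Qed.

Fact padic_add0 : left_id padic_zero padic_add.
Proof. by move=> x; apply: padic_intP => k /=; rewrite modzDml add0r padic_coord_mod. Qed.

Fact padic_addN : left_inverse padic_zero padic_opp padic_add.
Proof. by move=> x; apply: padic_intP => k /=; rewrite modzDml addNr. Qed.

HB.instance Definition _ :=
  GRing.isZmodule.Build Zp padic_addA padic_addC padic_add0 padic_addN.

Fact padic_mulA : associative padic_mul.
Proof. by move=> x y z; apply: padic_intP => k /=; rewrite modzMml modzMmr mulrA. Qed.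

Fact padic_mulC : commutative padic_mul.
Proof. by move=> x y; apply: padic_intP => k /=; rewrite mulrC. Qed.

Fact padic_mul1 : left_id padic_one padic_mul.
Proof. by move=> x; apply: padic_intP => k /=; rewrite modzMml mul1r padic_coord_mod. Qed.

Fact padic_mulDl : left_distributive padic_mul padic_add.
Proof. by move=> x y z; apply: padic_intP => k /=; rewrite modzMml modzDm mulrDl. Qed.

Fact padic_one_neq0 : padic_one != 0.
Proof.
apply/eqP => /(congr1 (fun x => padic_coord x 1)) /=.
by rewrite expn1 !modz_nat mod0n modn_small ?prime_gt1.
Qed.

HB.instance Definition _ := GRing.Zmodule_isComNzRing.Build Zp
  padic_mulA padic_mulC padic_mul1 padic_mulDl padic_one_neq0.

Definition padic_unit : {pred Zp} := fun x => `[< exists y, y * x = 1 >].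

Definition padic_inv x : Zp :=
  if pselect (exists y, y * x = 1) is left ex then sval (cid ex) else x.

Fact padic_mulVx : {in padic_unit, left_inverse 1 padic_inv *%R}.
Proof.
move=> x /asboolP ux; rewrite /padic_inv; case: pselect => // ex.
by case: (cid ex).
Qed.

Fact padic_unitPl x y : y * x = 1 -> padic_unit x.
Proof. by move=> yx1; apply/asboolP; exists y. Qed.

Fact padic_inv_out : {in [predC padic_unit], padic_inv =1 id}.
Proof.
move=> x /negP nux; rewrite /padic_inv; case: pselect => // ex.
by case: nux; apply/asboolP.
Qed.

HB.instance Definition _ := GRing.ComNzRing_hasMulInverse.Build Zp
  padic_mulVx padic_unitPl padic_inv_out.

Lemma padic_neq0 x : x != 0 -> exists k, padic_coord x k != 0.
Proof.
apply: contra_neqP => /forallNP x0; apply: padic_intP => k /=.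
by rewrite mod0z; apply/eqP; rewrite -[_ == _]negbK; apply/negP/x0.
Qed.

Fact padic_integral : GRing.integral_domain_axiom Zp.
Proof.
move=> x y xy0; apply/norP => -[/padic_neq0[m xm] /padic_neq0[n yn]].
have := congr1 (fun z => padic_coord z (m + n)) xy0.
rewrite /= mod0z => /dvdz_mod0P; move: xm yn.
rewrite (padic_coord_le x (leq_addr n m)) (padic_coord_le y (leq_addl m n)).
move: (padic_coord x _) (padic_coord y _) => a b.
rewrite -!(sameP dvdz_mod0P eqP) !dvdzE abszM /= => na nb.
have a0 : (0 < `|a|)%N by rewrite lt0n; apply: contraNneq na => ->; rewrite dvdn0.
have b0 : (0 < `|b|)%N by rewrite lt0n; apply: contraNneq nb => ->; rewrite dvdn0.
rewrite pfactor_dvdn ?muln_gt0 ?a0 // lognM //; apply/negP; rewrite -ltnNge.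
rewrite !pfactor_dvdn // -!ltnNge in na nb.
by rewrite -addSn leq_add // ltnW.
Qed.

HB.instance Definition _ :=
  GRing.ComUnitRing_isIntegral.Build Zp padic_integral.

Definition padic_ppow_dvd (k : nat) x : Prop := exists y, x = p%:R ^+ k * y.

(* The valuation of 0, which should be infinite, is the dummy value 0. *)
Definition padic_val x : nat :=
  xget 0%N [set k | padic_ppow_dvd k x /\ ~ padic_ppow_dvd k.+1 x]%classic.

End PadicRing.

Definition padic_poly (p : nat) (p_pr : prime p) (f : {poly int}) :
  {poly padic_int p_pr} := map_poly intr f.

(* The divisor is monic, so the pseudo-division [%/] is the Euclidean division
   of Z_p[x], which is exact here. *)
Definition root_cofactor (p : nat) (p_pr : prime p) (f : {poly int})
    (a : padic_int p_pr) : {poly padic_int p_pr} :=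
  (padic_poly p_pr f %/ ('X - a%:P) ^+ \mu_a (padic_poly p_pr f))%R.

Definition root_nu (p : nat) (p_pr : prime p) (f : {poly int})
    (a : padic_int p_pr) : nat :=
  padic_val (root_cofactor f a).[a].

Definition num_zeros (p : nat) (f : {poly int}) (k : nat) : nat :=
  #|[set a : 'I_(p ^ k) | ((p ^ k)%N %| f.[(a : nat)%:Z])%Z]|.

(* disc f = (-1)^(d(d-1)/2) Res(f, f') / lc(f); the quotient is exact. *)
Definition discriminant (f : {poly int}) : int :=
  ((-1) ^+ 'C((size f).-1, 2) * (resultant f f^`() %/ lead_coef f)%Z)%R.

(* Main.v *)
Require Import Defs.
From mathcomp Require Import all_boot all_order all_algebra.
From mathcomp Require Import boolp classical_sets reals exp.
From mathcomp Require Import perm qpoly polyorder zify ring lra.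
Import Order.TTheory GRing.Theory Num.Theory.

Set Implicit Arguments.
Unset Strict Implicit.
Unset Printing Implicit Defensive.

Local Open Scope ring_scope.

(** Write f = c q_1 ... q_l with q_i primitive and irreducible over Z. When the
    valuation of f(x) is large, x has to be close to a p-adic root of one of the
    q_i, and near a root a of multiplicity e the valuation of f(x) is
    nu + e v(x - a). The zeros of f modulo p^k therefore form disjoint balls
    around the roots, the one around a being a residue class modulo
    p^ceil((k - nu) / e), with p^(k - ceil((k - nu) / e)) elements modulo p^k
    ([num_zeros_balls]). All e are 1 if the discriminant is nonzero
    ([discriminant_mu]), and then the summands are p^nu, independent of k.

    What has to be quantified is how large the valuation must be. Let g be the
    product of the distinct q_i, and h = f / g. Then h also divides f', and the
    quotient w = f' / h is congruent modulo each q = q_i to a nonzero multiple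
    of q' times the product of the other distinct factors. As g and w are
    coprime, U g + W w = r for integer polynomials U, W and an integer r <> 0,
    of p-adic valuation D say. Consequently, if q(x) is divisible by p^(D + 1),
    then neither q'(x) nor any other factor at x is
    ([factor_dvd_separated]). Two things follow. If v(f(x)) > v(c) + 2 d D, then
    one of the q_i(x) has valuation above 2 D, and Hensel's lemma for that q_i
    gives a root of f that is congruent to x modulo p^(D + 1) ([near_root]). And
    on the residue class modulo p^(D + 1) of a root a, the cofactor
    f / (X - a)^e has constant valuation, at most v(c) + d D ([root_ball]). So
    the threshold v(c) + 2 d D + 1 works ([threshold]).

    It remains to bound r by (2 d C)^O(d), which makes D = O(d (log C + log d))
    when d C >= 2 ([threshold_bound]); the case d = C = 1 is treated directly
    ([linear_threshold]). The coefficients of g and w can be exponential in d, so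
    a resultant of g and w is too large. Instead, r is obtained by Cramer's rule
    from a square submatrix of the Sylvester matrix of f and f', whose entries
    are bounded by d C ([truncated_bezout]): the columns left out are those of
    degree less than deg h, and a multiple of h is determined by its other
    coefficients. *)

(** * Divisibility by powers of p in the ring of p-adic integers *)

Section PadicDivisibility.
Variables (p : nat) (p_pr : prime p).
Local Notation Zp := (padic_int p_pr).
Implicit Types (x y z : Zp) (i j k n : nat) (m : int).

(** A boolean form of [padic_ppow_dvd] (see [pdvdP]): p^k divides x exactly when
    the residue of x modulo p^k vanishes. *)
Definition pdvd k x : bool := padic_coord x k == 0.

Lemma ppow_neq0 k : (p ^ k)%N%:Z != 0.
Proof. by rewrite -lt0n expn_gt0 prime_gt0. Qed.

Lemma padic_coordD x y k :
  padic_coord (x + y) k = ((padic_coord x k + padic_coord y k) %% (p ^ k)%N)%Z.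
Proof. by []. Qed.

Lemma padic_coordM x y k :
  padic_coord (x * y) k = ((padic_coord x k * padic_coord y k) %% (p ^ k)%N)%Z.
Proof. by []. Qed.

Lemma padic_coordN x k : padic_coord (- x) k = ((- padic_coord x k) %% (p ^ k)%N)%Z.
Proof. by []. Qed.

Lemma padic_coord_int m k : padic_coord (m%:~R : Zp) k = (m %% (p ^ k)%N)%Z.
Proof.
have coordn n : padic_coord (n%:R : Zp) k = (n%:Z %% (p ^ k)%N)%Z.
  elim: n => [|n IHn]; first by [].
  by rewrite -natr1 padic_coordD IHn modzDm -addn1.
case: m => n; first exact: coordn.
by rewrite NegzE mulrNz padic_coordN coordn modzNm.
Qed.

Lemma padic_coord_sub x y k :
  pdvd k (x - y) = (padic_coord x k == padic_coord y k).
Proof.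
rewrite /pdvd padic_coordD padic_coordN modzDmr -(sameP dvdz_mod0P eqP).
by rewrite -eqz_mod_dvd !padic_coord_mod.
Qed.

Lemma pdvd_int k m : pdvd k m%:~R = ((p ^ k)%N %| m)%Z.
Proof. by rewrite /pdvd padic_coord_int (sameP dvdz_mod0P eqP). Qed.

Lemma pdvd0 k : pdvd k 0.
Proof. by rewrite -[0]/((0 : int)%:~R) pdvd_int dvdz0. Qed.

Lemma pdvd0n x : pdvd 0 x.
Proof. by rewrite /pdvd padic_coordS modz1. Qed.

Lemma pdvdD k x y : pdvd k x -> pdvd k y -> pdvd k (x + y).
Proof. by rewrite /pdvd padic_coordD => /eqP-> /eqP->; rewrite mod0z. Qed.

Lemma pdvdN k x : pdvd k (- x) = pdvd k x.
Proof.
suff h z : pdvd k z -> pdvd k (- z) by apply/idP/idP => /h //; rewrite opprK.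
by rewrite /pdvd padic_coordN => /eqP->; rewrite mod0z.
Qed.

Lemma pdvdMr k x y : pdvd k x -> pdvd k (x * y).
Proof. by rewrite /pdvd padic_coordM => /eqP->; rewrite mul0r mod0z. Qed.

Lemma pdvdMl k x y : pdvd k y -> pdvd k (x * y).
Proof. by rewrite mulrC; apply: pdvdMr. Qed.

Lemma pdvd_le j k x : (j <= k)%N -> pdvd k x -> pdvd j x.
Proof. by rewrite /pdvd => /padic_coord_le-> /eqP->; rewrite mod0z. Qed.

Lemma pdvd_inf x : (forall k, pdvd k x) -> x = 0.
Proof.
by move=> px; apply: padic_intP => k /=; rewrite mod0z; apply/eqP/px.
Qed.

Lemma pdvd_congr k x y : pdvd k (x - y) -> pdvd k x = pdvd k y.
Proof. by rewrite padic_coord_sub /pdvd => /eqP->. Qed.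

Lemma pdvd_ppow k x : pdvd k (p%:R ^+ k * x).
Proof.
by apply/pdvdMr; rewrite -natrX -[_%:R]/(_%:Z%:~R) pdvd_int dvdzz.
Qed.

(** If the residue of x modulo p^k is 0, then p^k divides all later residues,
    and the quotients, shifted by k places, are again a compatible sequence. *)
Lemma pdvdP k x : reflect (padic_ppow_dvd k x) (pdvd k x).
Proof.
apply: (iffP idP) => [px | [y ->]]; last exact: pdvd_ppow.
have dvd_coord j : ((p ^ k)%N %| padic_coord x (j + k))%Z.
  by apply/dvdz_mod0P; rewrite -padic_coord_le ?leq_addl //; apply/eqP.
pose u j := (padic_coord x (j + k) %/ (p ^ k)%N)%Z.
have uE j : padic_coord x (j + k) = u j * (p ^ k)%N by rewrite divzK.
have u_comp j : (u j = u j.+1 %[mod (p ^ j)%N])%Z.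
  apply/eqP; rewrite eqz_mod_dvd.
  rewrite -(dvdz_mul2r (ppow_neq0 k)).
  rewrite -PoszM -expnD mulrBl -!uE -eqz_mod_dvd; apply/eqP.
  by rewrite padic_coord_mod addSn -padic_coordS.
exists (padic_of p_pr u_comp); apply: padic_intP => j.
rewrite -natrX padic_coordM -[_%:R]/(_%:Z%:~R) padic_coord_int /= modzMml modzMmr.
by rewrite mulrC -uE -padic_coord_le ?leq_addr.
Qed.

Lemma ppow_padic_neq0 k : (p%:R ^+ k : Zp) != 0.
Proof.
apply: contraTneq (leqnn k.+1) => pk0; rewrite -ltnNge.
have : pdvd k.+1 ((p ^ k)%N%:Z%:~R : Zp) by rewrite -pmulrn natrX pk0 pdvd0.
rewrite pdvd_int dvdzE /= pfactor_dvdn ?expn_gt0 ?prime_gt0 //.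
by rewrite pfactorK // ltnn.
Qed.

Lemma pdvd_mulX k j x : pdvd (k + j) (p%:R ^+ k * x) = pdvd j x.
Proof.
apply/pdvdP/pdvdP => -[y]; last by move=> ->; exists y; rewrite exprD mulrA.
by rewrite exprD -mulrA => /(mulfI (ppow_padic_neq0 k)) ->; exists y.
Qed.

Lemma pdvdM k j x y : pdvd k x -> pdvd j y -> pdvd (k + j) (x * y).
Proof.
move=> /pdvdP[a ->] /pdvdP[b ->]; apply/pdvdP; exists (a * b).
by rewrite exprD mulrACA.
Qed.

Lemma pdvdE k x : pdvd k x = ((p ^ k)%N %| padic_coord x k)%Z.
Proof. by rewrite /pdvd -{1}padic_coord_mod (sameP eqP dvdz_mod0P). Qed.

(** The residue ring modulo p is a field, so p is a prime element. *)
Lemma pdvd1_mul x y : pdvd 1 (x * y) = pdvd 1 x || pdvd 1 y.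
Proof.
have dvdz_modr (d m : int) : (d %| (m %% d)%Z)%Z = (d %| m)%Z.
  by rewrite !(sameP dvdz_mod0P eqP) modz_mod.
by rewrite !pdvdE padic_coordM expn1 dvdz_modr !dvdzE abszM /= Euclid_dvdM.
Qed.

(** A p-adic integer prime to p is invertible modulo every power of p, and these
    inverses are compatible because an inverse modulo p^k is unique. *)
Lemma padic_unitE x : (x \is a GRing.unit) = ~~ pdvd 1 x.
Proof.
apply/idP/idP => [ux | nx].
  apply/negP => px; have : pdvd 1 (1 : Zp) by rewrite -(divrr ux) pdvdMr.
  rewrite -[1]/((1 : int)%:~R) pdvd_int dvdz1 expn1 /=.
  by rewrite gtn_eqF // prime_gt1.
have cop k : coprimez (padic_coord x k) (p ^ k)%N.
  case: k => [|k]; first by rewrite coprimezE coprimen1.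
  rewrite coprimezE /= coprimeXr // coprime_sym prime_coprime //.
  apply: contra nx => pd; rewrite /pdvd (@padic_coord_le _ _ x 1 k.+1) //.
  by rewrite expn1 (sameP eqP dvdz_mod0P) dvdzE.
have [u uP] : exists u : nat -> int,
    forall k, (u k * padic_coord x k = 1 %[mod (p ^ k)%N])%Z.
  suff ex k : {m | (m * padic_coord x k = 1 %[mod (p ^ k)%N])%Z}.
    by exists (fun k => sval (ex k)) => k; case: (ex k).
  apply: cid; have /coprimezP[[a b] /= ab] := cop k; exists a.
  by rewrite -ab addrC modzMDl.
have u_comp k : (u k = u k.+1 %[mod (p ^ k)%N])%Z.
  apply/eqP; rewrite eqz_mod_dvd.
  have : ((p ^ k)%N %| (u k - u k.+1) * padic_coord x k)%Z.
    rewrite mulrBl -eqz_mod_dvd uP padic_coordS modzMmr.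
    by rewrite -(modz_expS p (u k.+1 * _)) uP modz_expS.
  by rewrite Gauss_dvdzl // coprimez_sym.
apply/unitrP; exists (padic_of p_pr u_comp).
have E : padic_of p_pr u_comp * x = 1.
  by apply: padic_intP => k; rewrite padic_coordM /= modzMml uP.
by rewrite [x * _]mulrC.
Qed.

Lemma pdvd_total x : x != 0 -> exists n, pdvd n x && ~~ pdvd n.+1 x.
Proof.
move=> /padic_neq0 exk; case: (ex_minnP exk) => -[|k] xk mink.
  by move: (pdvd0n x) xk; rewrite /pdvd => ->.
exists k; rewrite xk andbT; apply: contraT => /mink; by rewrite ltnn.
Qed.

Lemma padic_valP x : x != 0 ->
  pdvd (padic_val x) x /\ ~~ pdvd (padic_val x).+1 x.
Proof.
move=> /pdvd_total[n /andP[/pdvdP xn /pdvdP nxn]]; rewrite /padic_val.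
by case: xgetP => [_ -> [/pdvdP-> /pdvdP->] | /(_ n) []].
Qed.

Lemma pdvd_val k x : x != 0 -> pdvd k x = (k <= padic_val x)%N.
Proof.
move=> /padic_valP[px npx]; case: leqP => h; first exact: pdvd_le px.
by apply: contraNF npx; apply: pdvd_le.
Qed.

Lemma pdvd_val_uniq n x : pdvd n x -> ~~ pdvd n.+1 x -> padic_val x = n.
Proof.
move=> xn nxn; have x0 : x != 0 by apply: contraNneq nxn => ->; rewrite pdvd0.
by apply/eqP; rewrite eqn_leq leqNgt -!pdvd_val // xn nxn.
Qed.

Lemma padic_val_le n x : ~~ pdvd n.+1 x -> (padic_val x <= n)%N.
Proof.
move=> nx; have x0 : x != 0 by apply: contraNneq nx => ->; rewrite pdvd0.
by rewrite leqNgt -pdvd_val.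
Qed.

Lemma padic_valM x y : x != 0 -> y != 0 ->
  padic_val (x * y) = (padic_val x + padic_val y)%N.
Proof.
move=> /padic_valP[/pdvdP[a xE] nx] /padic_valP[/pdvdP[b yE] ny].
move: (padic_val x) (padic_val y) => i j in xE nx yE ny *; subst x y.
move: nx ny; rewrite -(addn1 i) -(addn1 j) !pdvd_mulX => na nb.
rewrite mulrACA -exprD; apply: pdvd_val_uniq; first exact: pdvd_ppow.
by rewrite -addn1 pdvd_mulX pdvd1_mul negb_or na.
Qed.

Lemma padic_val1 : padic_val (1 : Zp) = 0%N.
Proof.
apply: pdvd_val_uniq; first exact: pdvd0n.
by rewrite -padic_unitE unitr1.
Qed.

Lemma padic_valX x n : x != 0 -> padic_val (x ^+ n) = (n * padic_val x)%N.
Proof.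
move=> x0; elim: n => [|n IHn]; first by rewrite padic_val1.
by rewrite exprS padic_valM ?expf_neq0 // IHn mulSn.
Qed.

(** The ultrametric inequality: x and y are divisible by the same p^j for all
    j up to n + 1, and the valuation of x is at most n. *)
Lemma padic_val_congr n x y : ~~ pdvd n.+1 x -> pdvd n.+1 (y - x) ->
  y != 0 /\ padic_val y = padic_val x.
Proof.
move=> nx yx; have ny : ~~ pdvd n.+1 y by rewrite (pdvd_congr yx).
have y0 : y != 0 by apply: contraNneq ny => ->; rewrite pdvd0.
have x0 : x != 0 by apply: contraNneq nx => ->; rewrite pdvd0.
split=> //; have [px npx] := padic_valP x0.
have le_n := padic_val_le nx.
apply: pdvd_val_uniq; first by rewrite (pdvd_congr (pdvd_le _ yx)) // ltnW.
by rewrite (pdvd_congr (pdvd_le _ yx)).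
Qed.

(** The diagonal: the n-th residue of u n is unchanged later on. *)
Lemma padic_complete (u : nat -> Zp) : (forall n, pdvd n (u n.+1 - u n)) ->
  exists a, forall n, pdvd n (a - u n).
Proof.
move=> u_cauchy.
have comp n : (padic_coord (u n) n = padic_coord (u n.+1) n.+1 %[mod (p ^ n)%N])%Z.
  rewrite -padic_coordS padic_coord_mod; apply/esym/eqP.
  by rewrite -padic_coord_sub.
exists (padic_of p_pr comp) => n.
by rewrite padic_coord_sub /= padic_coord_mod.
Qed.

Lemma intr_padic_eq0 m : ((m%:~R : Zp) == 0) = (m == 0).
Proof.
apply/eqP/eqP => [m0 | -> //]; apply: contraTeq isT => m_neq0.
have : pdvd `|m| (m%:~R : Zp) by rewrite m0 pdvd0.
rewrite pdvd_int dvdzE /= => /dvdn_leq; rewrite absz_gt0 => /(_ m_neq0).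
by rewrite leqNgt ltn_expl ?prime_gt1.
Qed.

End PadicDivisibility.

(** * Hensel's lemma *)

Lemma horner_taylor2 (R : comNzRingType) (P : {poly R}) (x h : R) :
  exists z, P.[x + h] = P.[x] + P^`().[x] * h + h ^+ 2 * z.
Proof.
rewrite (@nderiv_taylor_wide _ (size P).+2); [|by rewrite /GRing.comm mulrC|by lia].
exists (\sum_(i < size P) P^`N(i.+2).[x] * h ^+ i).
rewrite !big_ord_recl /= nderivn0 nderivn1 expr0 mulr1 expr1 addrA; congr (_ + _).
rewrite mulr_sumr; apply: eq_bigr => i _.
by rewrite /= /bump /= !add1n !exprS expr0; ring.
Qed.

Section Hensel.
Variables (p : nat) (p_pr : prime p).
Local Notation Zp := (padic_int p_pr).
Implicit Types (P : {poly Zp}) (x y a : Zp).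

Lemma pdvd_horner k P x y : pdvd k (x - y) -> pdvd k (P.[x] - P.[y]).
Proof.
move=> xy; have [z] := horner_taylor2 P y (x - y).
rewrite addrC subrK => ->; rewrite addrC !addrA addNr add0r expr2 -mulrA.
by apply: pdvdD; [apply: pdvdMl | apply: pdvdMr].
Qed.

(** Newton's iteration with the slope u frozen at its value at the initial point
    x. Since y stays close to x, the slope at y differs from u by a multiple of
    p^s; with s > e the resulting error is smaller than f(y), so each step gains
    at least one power of p, and it moves y by a multiple of p^(s + n) only. *)
Lemma hensel_step P x e s n y (u := P^`().[x]) :
    (e < s)%N -> pdvd e u -> ~~ pdvd e.+1 u ->
    pdvd (e + s + n) P.[y] -> pdvd s (y - x) ->
  exists y', [/\ pdvd (e + s + n.+1) P.[y'], pdvd s (y' - x)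
               & pdvd (s + n) (y' - y)].
Proof.
move=> es /pdvdP[v uE] nu /pdvdP[w Pw] yx.
have uv : v \is a GRing.unit by rewrite padic_unitE -(pdvd_mulX e) addn1 -uE.
pose h := - (p%:R ^+ (s + n) * (w / v)); exists (y + h).
have ph : pdvd (s + n) h by rewrite pdvdN pdvd_ppow.
have [z ->] := horner_taylor2 P y h.
split; last by rewrite addrC addKr.
  apply: pdvdD; last first.
    by rewrite expr2 -mulrA; apply/(pdvd_le _ (pdvdM ph (pdvdMr z ph))); lia.
  have -> : P.[y] + P^`().[y] * h = (P^`().[y] - u) * h.
    rewrite mulrBl [X in _ = X]addrC; congr (_ + _).
    rewrite uE Pw /h mulrN opprK -addnA exprD -!mulrA; congr (_ * _).
    by rewrite mulrCA; congr (_ * _); rewrite mulrCA divrr // mulr1.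
  by apply/(pdvd_le _ (pdvdM (pdvd_horner _ yx) ph)); lia.
by rewrite addrAC pdvdD //; apply: pdvd_le ph; rewrite leq_addr.
Qed.

(** Quantitative Hensel lemma: when the slope at x has valuation at most d, a
    value at x of valuation more than 2 d forces a root at distance less than
    p^(- d). *)
Lemma hensel P x d : pdvd d.*2.+1 P.[x] -> ~~ pdvd d.+1 P^`().[x] ->
  exists2 a, root P a & pdvd d.+1 (a - x).
Proof.
move=> Px nu; set u := P^`().[x] in nu.
have u0 : u != 0 by apply: contraNneq nu => ->; rewrite pdvd0.
have [pu npu] := padic_valP u0.
set e := padic_val u in pu npu; set s := d.+1.
have es : (e < s)%N by rewrite ltnS padic_val_le.
(* The precision s = d + 1 exceeds e, and e + s is at most 2 d + 1. *)
pose I n y := pdvd (e + s + n) P.[y] && pdvd s (y - x).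
have I0 : I 0 x.
  by rewrite /I subrr pdvd0 andbT; apply: pdvd_le Px; lia.
have step n (y : {y | I n y}) : {y' : {y | I n.+1 y} | pdvd (s + n) (sval y' - sval y)}.
  case: y => y /andP[Iy yx] /=; apply: cid.
  have [y' [h1 h2 h3]] := hensel_step es pu npu Iy yx.
  have Iy' : I n.+1 y' by rewrite /I h1.
  by exists (exist _ y' Iy').
pose it n := nat_rect (fun n => {y | I n y}) (exist _ x I0) 
    (fun n (y : {y | I n y}) => sval (step n y)) n.
pose U n := sval (it n).
have UI n : I n (U n) by rewrite /U; case: (it n).
have US n : pdvd n (U n.+1 - U n).
  by apply: pdvd_le (svalP (step n (it n))); rewrite leq_addl.
have [a aU] := padic_complete US; exists a; last first.
  rewrite -(subrK (U s) a) -addrA pdvdD //.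
  by have /andP[] := UI s.
apply/rootP/pdvd_inf => n; rewrite (pdvd_congr (pdvd_horner P (aU n))).
by have /andP[+ _] := UI n; apply: pdvd_le; rewrite leq_addl.
Qed.

End Hensel.

(** * Factorization of integer polynomials *)

(** Irreducibility is meant over the rationals, since divisibility of integer
    polynomials is taken up to a nonzero constant. A content equal to 1 also
    fixes the sign of the leading coefficient, so that associated polynomials of
    this kind are equal. *)
Definition zirreducible (q : {poly int}) := irreducible_poly q /\ zcontents q = 1.

Lemma zirreducible_size q : zirreducible q -> (1 < size q)%N.
Proof. by case=> -[]. Qed.

Lemma zirreducible_neq0 q : zirreducible q -> q != 0.
Proof. by move=> /zirreducible_size; case: eqP => // ->; rewrite size_poly0. Qed.

(** Gauss's lemma turns a factorization over the rationals into one over the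
    integers, with a constant coefficient. *)
Lemma int_poly_factor (f : {poly int}) : f != 0 ->
  exists c s, f = c *: \prod_(q <- s) q /\ forall q, q \in s -> zirreducible q.
Proof.
have [n] := ubnP (size f); elim: n f => // n IHn f; rewrite ltnS => fn f0.
have [f1 | f1] := leqP (size f) 1.
  by exists f`_0, [::]; rewrite big_nil alg_polyC -size1_polyC.
have [irrf | redf] := pselect (irreducible_poly (zprimitive f)).
  exists (zcontents f), [:: zprimitive f]; rewrite big_seq1 -zpolyEprim.
  split=> // q; rewrite inE => /eqP->; split=> //.
  by rewrite zcontents_primitive f0.
have [q [q1 qf nqf]] : exists q : {poly int}, [/\ size q != 1%N, q %| f & ~~ (q %= f)].
  apply: contrapT => nex; apply: redf; split; first by rewrite size_zprimitive.
  have eqf : zprimitive f %= f.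
    by rewrite {2}[f]zpolyEprim eqp_sym eqp_scale ?zcontents_eq0.
  move=> q q1; rewrite (eqp_dvdr _ eqf) => qf; rewrite (eqp_rtrans eqf).
  by apply: contrapT => nqf; apply: nex; exists q; split => //; apply/negP.
have [r fE] := dvdpP_int qf.
have [zq0 r0] : zprimitive q != 0 /\ r != 0.
  by apply/andP; rewrite -negb_or -mulf_eq0 -fE.
have q0 : q != 0 by rewrite -zprimitive_eq0.
have szq : (1 < size q)%N by move: q1 q0; rewrite -size_poly_gt0; case: size => [|[]].
have szf : size f = (size q + size r).-1 by rewrite fE size_mul // size_zprimitive.
have szr : (1 < size r)%N.
  rewrite ltnNge; apply: contra nqf => r1.
  rewrite -(dvdp_size_eqp qf) szf.
  by move: r0 r1; rewrite -size_poly_gt0; case: size => [|[]] //; rewrite addn1.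
have szp := size_zprimitive q.
have [||c1 [s1 [E1 irr1]]] := IHn (zprimitive q) => //.
  by move: szf szr fn; rewrite szp; lia.
have [||c2 [s2 [E2 irr2]]] := IHn r => //.
  apply: leq_trans fn; rewrite szf; case: (size q) szq => [|[|k]] // _.
  by rewrite !addSn /= ltnS leq_addl.
exists (c1 * c2), (s1 ++ s2); split; last first.
  by move=> u; rewrite mem_cat => /orP[/irr1 | /irr2].
by rewrite fE big_cat E1 E2 /= -scalerAl -scalerAr scalerA.
Qed.

Lemma zirreducible_dvdp q r : zirreducible q -> zirreducible r -> q %| r -> q = r.
Proof.
move=> zq [[_ irr] r1] qr; have [_ q1] := zq.
have /irr/(_ qr)/eqpP[[a b] /= /andP[a0 b0] E] : size q != 1%N.
  by rewrite gtn_eqF // zirreducible_size.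
have ab : a = b by move: (congr1 zcontents E); rewrite !zcontentsZ q1 r1 !mulr1.
by apply: (@mulfI _ a%:P); rewrite ?polyC_eq0 // !mul_polyC E ab.
Qed.

Lemma zirreducible_coprimep q u : zirreducible q -> coprimep q u = ~~ (q %| u).
Proof. by move=> [irr _]; apply: irreducible_poly_coprime. Qed.

Lemma coprimep_prod (I : eqType) q (r : seq I) (P : pred I) (F : I -> {poly int}) :
  (forall i, i \in r -> P i -> coprimep q (F i)) ->
  coprimep q (\prod_(i <- r | P i) F i).
Proof.
move=> cop; rewrite big_seq_cond; elim/big_rec: _ => [|i u /andP[ir Pi] qu].
  exact: coprimep1.
by rewrite coprimepMr cop.
Qed.

Lemma prod_zirreducible_dvdp t u : uniq t -> (forall q, q \in t -> zirreducible q) ->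
  (forall q, q \in t -> q %| u) -> \prod_(q <- t) q %| u.
Proof.
elim: t => [|q t IHt] /=; first by rewrite big_nil dvd1p.
case/andP=> qt ut irr dv; rewrite big_cons Gauss_dvdp.
  rewrite dv ?mem_head //=; apply: IHt => // r rt; first by apply: irr; rewrite inE rt orbT.
  by apply: dv; rewrite inE rt orbT.
have zq : zirreducible q by apply: irr; rewrite mem_head.
apply: coprimep_prod => // r rt _.
rewrite zirreducible_coprimep //; apply: contra qt => /zirreducible_dvdp ->//.
by apply: irr; rewrite inE rt orbT.
Qed.

Lemma zirreducible_coprimep_deriv q : zirreducible q -> coprimep q q^`().
Proof.
move=> zq; have q1 := zirreducible_size zq; rewrite zirreducible_coprimep //.
apply/negP => /dvdp_leq; rewrite -size_poly_eq0 size_deriv.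
by move: q1; case: size => [|[|n]] // _ /(_ isT); rewrite ltnn.
Qed.

(** * The logarithmic derivative *)

Lemma deriv_prod (R : comNzRingType) (I : eqType) (t : seq I) (F : I -> {poly R}) :
  uniq t ->
  (\prod_(i <- t) F i)^`() = \sum_(i <- t) (F i)^`() * \prod_(j <- t | j != i) F j.
Proof.
elim: t => [|a t IHt] /=; first by rewrite !big_nil derivC.
case/andP=> at_ ut; rewrite big_cons derivM IHt // [in RHS]big_cons big_cons eqxx /=.
congr (_ * _ + _).
  rewrite [RHS]big_seq_cond [LHS]big_seq; apply: eq_bigl => i.
  by case: (boolP (i \in t)) => //= it; rewrite (memPn at_).
rewrite mulr_sumr !big_seq; apply: eq_bigr => i it.
by rewrite big_cons eq_sym (memPn at_) // mulrCA.
Qed.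

Section LogDerivative.
Variables (c : int) (t : seq {poly int}) (m : {poly int} -> nat).
Hypotheses (ut : uniq t) (m_gt0 : forall q, q \in t -> (0 < m q)%N).

Let f := c *: \prod_(q <- t) q ^+ m q.
Let h := c *: \prod_(q <- t) q ^+ (m q).-1.

(** The numerator of f'/f = sum_q m(q) q'/q over the common denominator
    prod_q q: the factor h common to f and f' has been cancelled. *)
Definition log_deriv : {poly int} :=
  \sum_(q <- t) (q^`() * \prod_(r <- t | r != q) r) *+ m q.

Let prod_expS (P : pred {poly int}) :
  \prod_(q <- t | P q) q ^+ m q =
  \prod_(q <- t | P q) q ^+ (m q).-1 * \prod_(q <- t | P q) q.
Proof.
rewrite -big_split !(big_seq_cond P) /=; apply: eq_bigr => q /andP[qt _].
by rewrite -exprSr prednK ?m_gt0.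
Qed.

Lemma prod_expE : f = h * \prod_(q <- t) q.
Proof. by rewrite /f prod_expS scalerAl. Qed.

Lemma deriv_prod_expE : f^`() = h * log_deriv.
Proof.
rewrite /f /h derivZ deriv_prod // -scalerAl; congr (_ *: _).
rewrite mulr_sumr [LHS]big_seq [RHS]big_seq; apply: eq_bigr => q qt.
rewrite prod_expS deriv_exp (bigD1_seq q) //= !mulrnAl mulrnAr; congr (_ *+ _).
by rewrite -!mulrA mulrCA; congr (_ * _); rewrite mulrCA mulrA.
Qed.

(** All terms of the sum but the one of q are multiples of q. *)
Lemma log_deriv_mod q : q \in t ->
  exists u, log_deriv = (q^`() * \prod_(r <- t | r != q) r) *+ m q + q * u.
Proof.
move=> qt; rewrite /log_deriv (bigD1_seq q) //=.
exists (\sum_(i <- t | i != q) (i^`() * \prod_(r <- t | (r != i) && (r != q)) r) *+ m i).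
rewrite mulr_sumr; congr (_ + _); apply: eq_bigr => i iq.
rewrite -[in LHS]big_filter (bigD1_seq q) ?filter_uniq ?mem_filter ?qt ?andbT 1?eq_sym //=.
by rewrite big_filter_cond mulrnAr mulrCA.
Qed.

End LogDerivative.

(** * A truncated Sylvester matrix *)

(** The triangle inequality in the Leibniz formula. *)
Lemma ler_norm_det (R : numDomainType) n (A : 'M[R]_n) (B : R) :
  (forall i j, `|A i j| <= B) -> `|\det A| <= n`!%:R * B ^+ n.
Proof.
move=> AB; rewrite /determinant (le_trans (ler_norm_sum _ _ _)) //.
rewrite -card_Sn mulr_natl -sumr_const.
apply: ler_sum => s _; rewrite normrM normr_sign mul1r normr_prod.
rewrite -[n in leRHS]card_ord -prodr_const; apply: ler_prod => i _.
by rewrite normr_ge0 AB.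
Qed.

Lemma rVpolyE (R : nzRingType) n (v : 'rV[R]_n) : rVpoly v = \sum_(i < n) v 0 i *: 'X^i.
Proof.
rewrite /rVpoly poly_def; apply: eq_bigr => i _; congr (_ *: _).
by rewrite valK.
Qed.

(** Let A = h g and B = h w with g and w coprime. The combinations U A + W B with
    deg U < deg g - 1 and deg W < deg g fill the multiples of h of bounded
    degree, and the coefficients of degree at least deg h determine such a
    multiple. The Sylvester matrix of A and B with the other columns removed is
    therefore square and invertible. This bounds a Bezout constant of g and w in
    terms of the coefficients of A and B, although the coefficients of g and w
    themselves may be exponentially larger. *)
Section TruncatedSylvester.
Variables (g w h : {poly int}) (m : nat).
Hypotheses (gm : size g = m.+2) (wm : (size w <= m.+1)%N) (h0 : h != 0).
Hypothesis cop : forall U W : {poly int},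
  U * g + W * w = 0 -> (size W <= m.+1)%N -> W = 0.

Let n := (m + m.+1)%N.
Let e := (size h).-1.

(** The shifts of F, with the columns of degree less than deg h left out. *)
Definition mulcoef_mx k (F : {poly int}) : 'M[int]_(k, n) :=
  \matrix_(i < k, j < n) ('X^i * F)`_(e + j).

Lemma mul_mulcoef_mx k F (v : 'rV_k) (j : 'I_n) :
  (v *m mulcoef_mx k F) 0 j = (rVpoly v * F)`_(e + j).
Proof.
rewrite rVpolyE mulr_suml coef_sum mxE; apply: eq_bigr => i _.
by rewrite mxE -scalerAl coefZ.
Qed.

Definition tsylvester_mx : 'M[int]_n :=
  col_mx (mulcoef_mx m (h * g)) (mulcoef_mx m.+1 (h * w)).

Definition bezout_comb (v : 'rV[int]_n) : {poly int} :=
  rVpoly (lsubmx v) * g + rVpoly (rsubmx v) * w.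

Lemma mul_tsylvester_mx (v : 'rV_n) (j : 'I_n) :
  (v *m tsylvester_mx) 0 j = (h * bezout_comb v)`_(e + j).
Proof.
rewrite -{1}[v]hsubmxK mul_row_col mxE !mul_mulcoef_mx -coefD.
by rewrite /bezout_comb mulrDr ![h * (_ * _)]mulrCA.
Qed.

Lemma size_bezout_comb v : (size (bezout_comb v) <= n)%N.
Proof.
rewrite (leq_trans (size_polyD _ _)) // geq_max; apply/andP; split.
  apply: leq_trans (size_polyMleq _ _) _; rewrite gm addnS /= /n leq_add2r.
  exact: size_poly.
apply: leq_trans (size_polyMleq _ _) _.
have := leq_add (size_poly _ _ : (size (rVpoly (rsubmx v)) <= m.+1)%N) wm.
by rewrite /n; case: (_ + size w)%N => //= k; rewrite addSn ltnS.
Qed.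

(** The leading coefficient of a nonzero multiple of h has degree at least
    deg h, hence it is visible in the truncated matrix. *)
Lemma size_bezout_comb_le v k :
    (forall j : 'I_n, (k <= j)%N -> (v *m tsylvester_mx) 0 j = 0) ->
  (size (bezout_comb v) <= k)%N.
Proof.
move=> vM; set T := bezout_comb v; have [-> | T0] := eqVneq T 0.
  by rewrite size_poly0.
rewrite leqNgt; apply/negP => kT.
have jn : ((size T).-1 < n)%N.
  by have := size_bezout_comb v; rewrite -/T; move: kT; case: size.
have /vM/eqP : (k <= Ordinal jn)%N by move: kT; rewrite /=; case: size.
rewrite mul_tsylvester_mx -/T /=.
have -> : (e + (size T).-1)%N = (size (h * T)).-1.
  rewrite size_mul // /e; move: h0 T0; rewrite -!size_poly_gt0.
  by move: (size h) (size T) => [|a] [|b] // _ _; rewrite addSn addnS.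
by rewrite -lead_coefE lead_coef_eq0 mulf_eq0 (negPf h0) (negPf T0).
Qed.

(** A vector in the kernel is a syzygy of g and w of too small a degree. *)
Lemma det_tsylvester_neq0 : \det tsylvester_mx != 0.
Proof.
apply/det0P => -[v v0 vM]; case/negP: v0.
have : (size (bezout_comb v) <= 0)%N.
  by apply: size_bezout_comb_le => j _; rewrite vM mxE.
rewrite leqn0 size_poly_eq0 /bezout_comb => /eqP E.
have W0 := cop E (size_poly _ _); move: E; rewrite W0 mul0r addr0 => /eqP.
rewrite mulf_eq0 -[g == 0]size_poly_eq0 gm orbF => /eqP U0.
rewrite -[v]hsubmxK -(rVpolyK (lsubmx v)) -(rVpolyK (rsubmx v)) W0 U0.
by rewrite !linear0 row_mx0.
Qed.

(** Cramer's rule: the first row of the adjugate yields a combination h T whose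
    coefficients vanish above degree deg h, where it is the determinant. So T is
    a constant t, and the determinant is t times the leading coefficient of h. *)
Lemma truncated_bezout (B : nat) :
    (forall i, `|(h * g)`_i| <= B%:Z) -> (forall i, `|(h * w)`_i| <= B%:Z) ->
  exists U W : {poly int}, exists2 t : int,
    U * g + W * w = t%:P & (0 < `|t|%N <= n`! * B ^ n)%N.
Proof.
move=> gB wB; have n0 : (0 < n)%N by rewrite /n addnS.
pose v := row (Ordinal n0) (\adj tsylvester_mx); set M := tsylvester_mx in v *.
have vM (j : 'I_n) : (v *m M) 0 j = \det M *+ (j == 0%N :> nat).
  by rewrite -row_mul mul_adj_mx !mxE eq_sym.
have T1 : (size (bezout_comb v) <= 1)%N.
  by apply: size_bezout_comb_le => j j0; rewrite vM gtn_eqF.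
exists (rVpoly (lsubmx v)), (rVpoly (rsubmx v)), (bezout_comb v)`_0.
  by rewrite -size1_polyC.
set t := _`_0; have E : \det M = lead_coef h * t.
  have := vM (Ordinal n0); rewrite mulr1n mul_tsylvester_mx addn0 => <-.
  by rewrite (size1_polyC T1) coefMC.
have t0 : t != 0.
  by apply: contraNneq det_tsylvester_neq0; rewrite -/M E => ->; rewrite mulr0.
rewrite absz_gt0 t0 /= -lez_nat; apply: (@le_trans _ _ `|\det M|).
  rewrite E normrM ler_peMl // -gtz0_ge1 normr_gt0 lead_coef_eq0 //.
have -> : (n`! * B ^ n)%N%:Z = n`!%:R * B%:Z ^+ n by rewrite -!natz natrM natrX.
apply: ler_norm_det => i j; rewrite mxE.
by case: splitP => k _; rewrite mxE coefXnM; case: ifP => _; rewrite ?normr0.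
Qed.

End TruncatedSylvester.

(** * Separation of the irreducible factors *)

Lemma zirreducible_coprimep_cofactor t q : uniq t ->
    (forall r, r \in t -> zirreducible r) -> q \in t ->
  coprimep q (q^`() * \prod_(r <- t | r != q) r).
Proof.
move=> ut irr qt; have zq := irr q qt.
rewrite coprimepMr zirreducible_coprimep_deriv //; apply: coprimep_prod => r rt rq.
rewrite zirreducible_coprimep //; apply: contra rq => /(zirreducible_dvdp zq) -> //.
exact: irr.
Qed.

(** Modulo q, the logarithmic derivative is m(q) q' times the other factors,
    and none of these is divisible by the irreducible q. *)
Lemma log_deriv_coprimep t m q : uniq t -> (forall r, r \in t -> (0 < m r)%N) ->
    (forall r, r \in t -> zirreducible r) -> q \in t ->
  coprimep q (log_deriv t m).
Proof.
move=> ut m_gt0 irr qt; have [u ->] := log_deriv_mod m ut qt.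
rewrite (zirreducible_coprimep _ (irr q qt)) dvdp_addl ?dvdp_mulr ?dvdpp //.
rewrite -scaler_nat dvdpZr; last by rewrite pnatr_eq0 -lt0n m_gt0.
rewrite -(zirreducible_coprimep _ (irr q qt)).
exact: zirreducible_coprimep_cofactor.
Qed.

Lemma fact_le_expn n : (n`! <= n ^ n)%N.
Proof.
elim: n => // n IHn; rewrite factS expnS leq_mul2l /= (leq_trans IHn) //.
by case: n {IHn} => // n; rewrite leq_exp2r.
Qed.

(** The integer r controls how close the distinct irreducible factors of f come
    to each other and to having double roots. Its logarithm is
    O(d (log C + log d)): the truncated Sylvester matrix of f and f' has size
    less than 2 d and entries at most d C, whereas bounding the discriminant of
    the radical of f through the size of its coefficients would add a term
    d^2. *)
Lemma factor_separation (f : {poly int}) (d C : nat) :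
    (0 < d)%N -> size f = d.+1 -> (forall i, `|f`_i| <= C%:Z) ->
  exists (c : int) (s : seq {poly int}) (r : int),
  [/\ f = c *: \prod_(q <- s) q,
      (0 < `|c|%N <= C)%N /\ (size s <= d)%N,
      (0 < `|r|%N <= d.*2 ^ d.*2 * (d * C) ^ d.*2)%N
    & forall q, q \in s -> exists Y Z : {poly int},
        Y * q + Z * (q^`() * \prod_(u <- undup s | u != q) u) = r%:P].
Proof.
move=> d0 szf fC; have f0 : f != 0 by rewrite -size_poly_gt0 szf.
have [c [s [fE irr]]] := int_poly_factor f0.
have c0 : c != 0 by apply: contraNneq f0 => c0; rewrite fE c0 scale0r.
set t := undup s; pose m q := count_mem q s.
have ut : uniq t by apply: undup_uniq.
have m_gt0 q : q \in t -> (0 < m q)%N by rewrite mem_undup -has_count has_pred1.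
have irrt q : q \in t -> zirreducible q by rewrite mem_undup; apply: irr.
have fE' : f = c *: \prod_(q <- t) q ^+ m q.
  by rewrite fE -big_undup_iterop_count.
pose g := \prod_(q <- t) q; pose h := c *: \prod_(q <- t) q ^+ (m q).-1.
pose w := log_deriv t m.
have fhg : f = h * g by rewrite fE' prod_expE.
have fhw : f^`() = h * w by rewrite fE' deriv_prod_expE.
have [h0 g0] : h != 0 /\ g != 0 by apply/andP; rewrite -negb_or -mulf_eq0 -fhg.
have szhg : d.+1 = (size h + size g).-1 by rewrite -szf fhg size_mul.
have w0 : w != 0.
  apply: contraTneq d0 => w0; have := size_deriv f.
  by rewrite fhw w0 mulr0 size_poly0 szf /= => <-.
have szhw : d = (size h + size w).-1 by rewrite -size_mul // -fhw size_deriv szf.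
have sg1 : (1 < size g)%N.
  have [q qs] : exists q, q \in t.
    case: (t) fE' => [|q ?]; last by exists q; rewrite mem_head.
    move=> /(congr1 (fun F : {poly int} => size F)); rewrite szf big_nil.
    rewrite alg_polyC size_polyC c0 => -[d00]; by rewrite d00 in d0.
  rewrite (leq_trans (zirreducible_size (irrt q qs))) // dvdp_leq //.
  by rewrite /g (bigD1_seq q) //= dvdp_mulr ?dvdpp.
(* The radical g has degree k + 1, and log_deriv has degree k. *)
pose k := (size g).-2.
have gk : size g = k.+2 by rewrite /k; move: sg1; case: size => [|[]].
have wk : (size w <= k.+1)%N.
  move: szhg szhw h0; rewrite gk -size_poly_gt0.
  by move: (size h) (size w) => [|a] // b; rewrite !addSn !addnS /=; lia.
have kd : (k.+1 <= d)%N.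
  move: szhg h0; rewrite gk -size_poly_gt0.
  by move: (size h) => [|a] //; rewrite !addSn !addnS /=; lia.
have cop (U W : {poly int}) : U * g + W * w = 0 -> (size W <= k.+1)%N -> W = 0.
  move=> E; have [-> // | W0] := eqVneq W 0; move=> Wk.
  suff : (size g <= size W)%N by rewrite gk leqNgt ltnS Wk.
  rewrite dvdp_leq // prod_zirreducible_dvdp // => q qt.
  rewrite -(Gauss_dvdpl _ (log_deriv_coprimep ut m_gt0 irrt qt)) -/w.
  rewrite -(dvdp_addr _ (_ : q %| U * g)) ?E ?dvdp0 //.
  by rewrite dvdp_mull // /g (bigD1_seq q) //= dvdp_mulr ?dvdpp.
have Cge i : (`|(f`_i)%R| <= C)%N by rewrite -lez_nat; apply: fC.
have C0 : (0 < C)%N.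
  by apply: leq_trans (Cge d); rewrite absz_gt0 -[d]/(d.+1.-1) -szf lead_coef_eq0.
have hgC i : `|(h * g)`_i| <= (d * C)%N%:Z.
  rewrite -fhg (le_trans (fC i)) // lez_nat leq_pmull //.
have hwC i : `|(h * w)`_i| <= (d * C)%N%:Z.
  rewrite -fhw coef_deriv; have [id|di] := ltnP i d; last first.
    by rewrite nth_default ?mul0rn ?normr0 // szf ltnS.
  by rewrite normrMn -mulr_natl PoszM natz ler_pM // lez_nat.
have [U [W [r Er rB]]] := truncated_bezout gk wk h0 cop hgC hwC.
exists c, s, r; split=> //.
- split.
    rewrite absz_gt0 c0 (leq_trans _ (Cge d)) //.
    rewrite fE coefZ abszM leq_pmulr // absz_gt0.
    apply: contraTneq d0 => E.
    have : lead_coef f = 0 by rewrite /lead_coef szf fE coefZ E mulr0.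
    by move/eqP; rewrite lead_coef_eq0 (negPf f0).
  rewrite -ltnS -szf fE size_scale //.
  elim: (s) irr => [|q s' IHs] irr'; first by rewrite big_nil size_poly1.
  have zq : zirreducible q by apply: irr'; rewrite mem_head.
  rewrite big_cons size_mul ?(zirreducible_neq0 zq) //; last first.
    rewrite prodf_seq_neq0; apply/allP => u us; apply/zirreducible_neq0/irr'.
    by rewrite inE us orbT.
  have := zirreducible_size zq.
  have /IHs : forall u, u \in s' -> zirreducible u.
    by move=> u us; apply: irr'; rewrite inE us orbT.
  by set u := \prod_(j <- s') j; move: (size u) (size q) => a b /=; lia.
- case/andP: rB => -> rB /=; apply: leq_trans rB _.
  have kd2 : (k + k.+1 <= d.*2)%N by rewrite -addnn; lia.
  apply: leq_mul.
    apply: leq_trans (fact_le_expn _) _.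
    apply: leq_trans (_ : (d.*2) ^ (k + k.+1) <= _)%N; first by rewrite leq_exp2r // addnS.
    by rewrite leq_pexp2l // double_gt0.
  by rewrite leq_pexp2l // muln_gt0 d0.
- move=> q qs; have qt : q \in t by rewrite mem_undup.
  have [u wE] := log_deriv_mod m ut qt.
  exists (U * \prod_(v <- t | v != q) v + W * u), (W *+ m q).
  rewrite -Er /w wE /g (bigD1_seq q) //= mulrDl !mulrDr -[in RHS]mulr_natl -mulr_natl.
  by ring.
Qed.

(** * Local analysis near the p-adic roots *)

Section LocalAnalysis.
Variables (p : nat) (p_pr : prime p).
Local Notation Zp := (padic_int p_pr).
Implicit Types (x y a : Zp).

(** The bound n is carried along because it adds up over products, just as the
    valuations do. *)
Definition same_val n x y :=
  [/\ x != 0, y != 0, padic_val x = padic_val y & (padic_val y <= n)%N].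

Lemma same_valM n1 n2 x1 x2 y1 y2 : same_val n1 x1 y1 -> same_val n2 x2 y2 ->
  same_val (n1 + n2) (x1 * x2) (y1 * y2).
Proof.
move=> [x1_0 y1_0 E1 le1] [x2_0 y2_0 E2 le2].
by split; rewrite ?mulf_neq0 ?padic_valM // ?E1 ?E2 ?leq_add.
Qed.

Lemma same_val_prod (I : eqType) (s : seq I) n (F G : I -> Zp) :
    (forall i, i \in s -> same_val n (F i) (G i)) ->
  same_val (size s * n) (\prod_(i <- s) F i) (\prod_(i <- s) G i).
Proof.
elim: s => [|i s IHs] FG.
  by rewrite !big_nil; split; rewrite ?oner_neq0 ?padic_val1.
rewrite !big_cons mulSn; apply: same_valM; first exact/FG/mem_head.
by apply: IHs => j js; apply: FG; rewrite inE js orbT.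
Qed.

Lemma same_val_congr n x y : ~~ pdvd n.+1 y -> pdvd n.+1 (x - y) -> same_val n x y.
Proof.
move=> ny xy; have [x0 xyE] := padic_val_congr ny xy; split=> //.
  by apply: contraNneq ny => ->; rewrite pdvd0.
exact: padic_val_le.
Qed.

Lemma same_val_int m : m != 0 -> same_val (logn p `|m|) (m%:~R : Zp) m%:~R.
Proof.
move=> m0; apply: same_val_congr; last by rewrite subrr pdvd0.
by rewrite pdvd_int dvdzE /= pfactor_dvdn ?absz_gt0 // ltnn.
Qed.

Lemma padic_poly_horner_int (f : {poly int}) (m : int) :
  (padic_poly p_pr f).[m%:~R] = f.[m]%:~R.
Proof. by rewrite horner_map. Qed.

Variables (f : {poly int}) (c : int) (s : seq {poly int}) (r : int).
Hypotheses (fE : f = c *: \prod_(q <- s) q) (c0 : c != 0) (r0 : r != 0).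
Hypothesis sep : forall q, q \in s -> exists Y Z : {poly int},
  Y * q + Z * (q^`() * \prod_(u <- undup s | u != q) u) = r%:P.

Local Notation ev := (padic_poly p_pr).
Let D := logn p `|r|.
Let V := logn p `|c|.

(** Evaluate the Bezout identity at x: if p^(D + 1) divided q(x) and also q'(x)
    or another factor at x, it would divide r, whose valuation is D. *)
Lemma factor_dvd_separated x q : q \in s -> pdvd D.+1 (ev q).[x] ->
  ~~ pdvd D.+1 (ev q)^`().[x] /\
  forall u, u \in s -> u != q -> ~~ pdvd D.+1 (ev u).[x].
Proof.
move=> qs qx; have [Y [Z E]] := sep qs.
suff nqx : ~~ pdvd D.+1 (ev (q^`() * \prod_(u <- undup s | u != q) u)).[x].
  split=> [|u us uq].
    apply: contra nqx; rewrite /padic_poly rmorphM hornerM deriv_map.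
    exact: pdvdMr.
  apply: contra nqx => ux; rewrite -big_filter (bigD1_seq u) /=.
  - by rewrite /padic_poly !rmorphM !hornerM; apply/pdvdMl/pdvdMr.
  - by rewrite mem_filter uq mem_undup.
  - by rewrite filter_uniq ?undup_uniq.
apply: contraTN isT => qux.
have : pdvd D.+1 (r%:~R : Zp).
  have := congr1 (fun P => (ev P).[x]) E; rewrite /padic_poly map_polyC hornerC => <-.
  rewrite rmorphD hornerD; apply: pdvdD; rewrite rmorphM hornerM.
    exact: pdvdMl qx.
  exact: pdvdMl qux.
by rewrite pdvd_int dvdzE /= pfactor_dvdn ?absz_gt0 // ltnn.
Qed.

Lemma padic_polyE : ev f = c%:~R%:P * \prod_(q <- s) ev q.
Proof.
by rewrite fE -mul_polyC /padic_poly rmorphM /= map_polyC rmorph_prod.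
Qed.

(** If f(x) is highly divisible by p, then so is q(x) for one of the [size s]
    factors q. The derivative of q at x has valuation at most D, so that
    Hensel's lemma applies to q. Working with q instead of f makes multiple
    roots of f harmless. *)
Lemma near_root k x : (V + size s * D.*2 < k)%N -> pdvd k (ev f).[x] ->
  exists2 a, root (ev f) a & pdvd D.+1 (x - a).
Proof.
move=> ltk fx.
have [q qs qx] : exists2 q, q \in s & pdvd D.*2.+1 (ev q).[x].
  apply: contrapT => nex; have nq q : q \in s -> ~~ pdvd D.*2.+1 (ev q).[x].
    by move=> qs; apply/negP => qx; apply: nex; exists q.
  have sq q : q \in s -> same_val D.*2 (ev q).[x] (ev q).[x].
    by move=> qs; apply: same_val_congr; rewrite ?subrr ?pdvd0 // nq.
  have [y0 _ _ le_y] := same_valM (same_val_int c0) (same_val_prod sq).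
  have E : (ev f).[x] = c%:~R * \prod_(q <- s) (ev q).[x].
    by rewrite padic_polyE hornerM hornerC horner_prod.
  move: fx; rewrite E pdvd_val // => le_k.
  by have := leq_ltn_trans (leq_trans le_k le_y) ltk; rewrite ltnn.
have [|ndq _] := factor_dvd_separated qs (_ : pdvd D.+1 (ev q).[x]).
  by apply: pdvd_le qx; rewrite ltnS -addnn leq_addr.
have [a qa ax] := hensel qx ndq; exists a; last by rewrite -pdvdN opprB.
by rewrite padic_polyE rootM (big_rem q) //= rootM qa orbT.
Qed.

(** A root a of f is a root of a single factor q = (X - a) h, and h(a) = q'(a).
    The cofactor of f at a is thus, up to the content, a product of
    [size s] factors (copies of h, and irreducible factors other than q), each
    of valuation at most D at a. Such values are stable under perturbations
    divisible by p^(D + 1). *)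
Lemma root_ball a : root (ev f) a ->
  [/\ ev f = root_cofactor f a * ('X - a%:P) ^+ \mu_a (ev f),
      (0 < \mu_a (ev f) <= size s)%N,
      (root_nu f a <= V + size s * D)%N
    & forall x, pdvd D.+1 (x - a) -> (root_cofactor f a).[x] != 0 /\
        padic_val (root_cofactor f a).[x] = root_nu f a].
Proof.
move=> fa; have [q qs qa] : exists2 q, q \in s & root (ev q) a.
  move: fa; rewrite padic_polyE /root hornerM hornerC mulf_eq0 intr_padic_eq0 (negPf c0).
  by rewrite horner_prod prodf_seq_eq0 => /hasP[q qs /= qa]; exists q.
have qa0 : pdvd D.+1 (ev q).[a] by rewrite (rootP qa) pdvd0.
have [ndq nu] := factor_dvd_separated qs qa0.
have /factor_theorem[h hE] := qa.
have ha : h.[a] = (ev q)^`().[a].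
  by rewrite hE derivM derivXsubC mulr1 hornerD hornerM hornerXsubC subrr mulr0 add0r.
pose G u := if u == q then h else ev u.
pose F := c%:~R%:P * \prod_(u <- s) G u.
have sF x : pdvd D.+1 (x - a) -> same_val (V + size s * D) F.[x] F.[a].
  move=> xa; rewrite !hornerM !hornerC !horner_prod.
  apply: same_valM; first exact: same_val_int.
  apply: same_val_prod => u us; apply: same_val_congr; last exact: pdvd_horner.
  by rewrite /G; case: eqP => [_ | /eqP uq]; rewrite ?ha // nu.
have [Fa0 _ _ Fa_le] : same_val (V + size s * D) F.[a] F.[a].
  by apply: sF; rewrite subrr pdvd0.
pose e := count_mem q s.
have fF : ev f = F * ('X - a%:P) ^+ e.
  rewrite padic_polyE /F -mulrA; congr (_ * _).
  rewrite /e; elim: (s) => [|u t IHt]; first by rewrite !big_nil mulr1.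
  rewrite !big_cons IHt /= exprD /G; case: eqP => [->|_].
    by rewrite hE expr1 -!mulrA; congr (_ * _); apply: mulrCA.
  by rewrite expr0 mul1r mulrA.
have muE : \mu_a (ev f) = e by rewrite fF cofactor_XsubC_mu.
have FE : root_cofactor f a = F.
  rewrite /root_cofactor muE fF.
  by rewrite Pdiv.IdomainMonic.mulpK // monic_exp // monicXsubC.
have nuE : root_nu f a = padic_val F.[a] by rewrite /root_nu FE.
rewrite FE muE nuE; split=> //.
  by rewrite /e -has_count has_pred1 qs count_size.
by move=> x /sF[Fx _ -> _].
Qed.

End LocalAnalysis.

(** * Counting zeros modulo a power of p *)

Lemma card_congr_class (M n c : nat) : (c < M)%N ->
  #|[set a : 'I_(M * n) | a %% M == c]%N| = n.
Proof.
move=> cM; have lt_i (i : 'I_n) : (i * M + c < M * n)%N.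
  by rewrite mulnC; have := ltn_ord i; nia.
pose F i := Ordinal (lt_i i).
have F_inj : injective F.
  move=> i j /(congr1 val) /= /addIn /eqP.
  by rewrite eqn_pmul2r ?(leq_ltn_trans _ cM) // => /eqP/val_inj.
rewrite -[RHS]card_ord -cardsT -(card_imset _ F_inj); apply: eq_card => a.
rewrite inE; apply/eqP/imsetP => [ac | [i _ ->]] /=; last by rewrite modnMDl modn_small.
have lt_n : (a %/ M < n)%N by rewrite ltn_divLR ?(leq_ltn_trans _ cM) // [X in (_ < X)%N]mulnC.
by exists (Ordinal lt_n) => //; apply/val_inj; rewrite /= -ac -divn_eq.
Qed.

Lemma card_set_has (T : finType) (I : eqType) (s : seq I) (P : I -> pred T) :
    uniq s -> (forall i j a, i \in s -> j \in s -> P i a -> P j a -> i = j) ->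
  #|[set a | has (P^~ a) s]| = (\sum_(i <- s) #|[set a | P i a]|)%N.
Proof.
move=> us disj; transitivity (\sum_a \sum_(i <- s) (P i a : nat))%N.
  rewrite -sum1_card big_mkcond; apply: eq_bigr => a _; rewrite inE.
  case: hasP => [[i si Pia] | nP].
    rewrite (bigD1_seq i) //= Pia big_seq_cond big1 // => j /andP[sj ji].
    by apply/eqP; rewrite eqb0; apply: contra ji => /(disj _ _ _ sj si)/(_ Pia) ->.
  rewrite big_seq big1 // => i si; apply/eqP; rewrite eqb0; apply/negP => Pia.
  by case: nP; exists i.
rewrite exchange_big; apply: eq_bigr => i _ /=; rewrite -sum1_card [RHS]big_mkcond.
by apply: eq_bigr => a _; rewrite inE; case: (P i a).
Qed.

(** For v <= k this is the ceiling of (k - v) / e; see [ceil_ball_exp]. *)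
Definition ball_exp (k v e : nat) := ((k - v + e.-1) %/ e)%N.

Lemma ball_exp_le k v e n : (0 < e)%N -> (ball_exp k v e <= n)%N = (k <= v + n * e)%N.
Proof.
case: e => // e _; rewrite /ball_exp /= -ltnS ltn_divLR // mulSn.
by rewrite [(e.+1 + _)%N]addnC addnS ltnS leq_add2r leq_subLR.
Qed.

Section Counting.
Variables (p : nat) (p_pr : prime p).
Local Notation Zp := (padic_int p_pr).
Local Notation ev := (padic_poly p_pr).

(** The ball of radius p^(- j) around a is one residue class modulo p^j. *)
Lemma card_ball (a : Zp) k j : (j <= k)%N ->
  #|[set n : 'I_(p ^ k) | pdvd j ((n : nat)%:Z%:~R - a)]| = (p ^ (k - j))%N.
Proof.
move=> jk; have pj0 : (0 < p ^ j)%N by rewrite expn_gt0 prime_gt0.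
pose c := `|padic_coord a j|%N.
have cE : padic_coord a j = c%:Z.
  by rewrite /c gez0_abs // padic_coordS modz_ge0 // ppow_neq0.
have cM : (c < p ^ j)%N.
  by rewrite -ltz_nat -cE padic_coordS ltz_pmod.
rewrite -[RHS](card_congr_class (p ^ (k - j)) cM).
have kE : (p ^ j * p ^ (k - j) = p ^ k)%N by rewrite -expnD subnKC.
rewrite kE; apply: eq_card => n; rewrite !inE padic_coord_sub padic_coord_int cE.
by rewrite modz_nat.
Qed.

(** On the ball of radius p^(- j) around a root a the valuation of f(x) is
    nu + mu v(x - a), hence f(x) is divisible by p^k exactly when x lies in the
    ball of radius p^(- ceil((k - nu) / mu)). These balls around the roots are
    disjoint, because the cofactor of f at a does not vanish at a root near
    a. *)
Lemma num_zeros_balls (f : {poly int}) (alpha : seq Zp) (k j : nat) :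
    ev f != 0 -> uniq alpha -> (forall a, (a \in alpha) = root (ev f) a) ->
    (forall x, pdvd k (ev f).[x] -> exists2 a, root (ev f) a & pdvd j (x - a)) ->
    (forall a, root (ev f) a ->
      ev f = root_cofactor f a * ('X - a%:P) ^+ \mu_a (ev f) /\
      forall x, pdvd j (x - a) -> (root_cofactor f a).[x] != 0 /\
        padic_val (root_cofactor f a).[x] = root_nu f a) ->
    (forall a, root (ev f) a -> (j <= ball_exp k (root_nu f a) (\mu_a (ev f)))%N) ->
  num_zeros p f k =
    (\sum_(a <- alpha) p ^ (k - ball_exp k (root_nu f a) (\mu_a (ev f))))%N.
Proof.
move=> f0 ua alphaE near ball j_le; pose L a := ball_exp k (root_nu f a) (\mu_a (ev f)).
have L_le a n : root (ev f) a -> (L a <= n)%N = (k <= root_nu f a + n * \mu_a (ev f))%N.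
  by move=> fa; rewrite ball_exp_le ?mu_gt0.
have ballE a x : root (ev f) a -> pdvd j (x - a) -> pdvd k (ev f).[x] = pdvd (L a) (x - a).
  move=> fa xa; have [fE /(_ x xa)[F0 nuE]] := ball a fa.
  have [-> | xa0] := eqVneq x a; first by rewrite (rootP fa) subrr !pdvd0.
  have {}xa0 : x - a != 0 by rewrite subr_eq0.
  have E : (ev f).[x] = (root_cofactor f a).[x] * (x - a) ^+ \mu_a (ev f).
    by rewrite {1}fE hornerM horner_exp hornerXsubC.
  rewrite E !pdvd_val ?mulf_neq0 ?expf_neq0 // padic_valM ?expf_neq0 //.
  by rewrite padic_valX // nuE L_le // mulnC.
have zeroP (x : Zp) : pdvd k (ev f).[x] = has (fun a => pdvd (L a) (x - a)) alpha.
  apply/idP/hasP => [kx | [a]].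
    have [a fa xa] := near x kx; exists a; first by rewrite alphaE.
    by rewrite -ballE.
  by rewrite alphaE => fa xa; rewrite (ballE a) //; apply: pdvd_le xa; apply: j_le.
rewrite /num_zeros.
transitivity #|[set n : 'I_(p ^ k) | has (fun a => pdvd (L a) ((n : nat)%:Z%:~R - a)) alpha]|.
  by apply: eq_card => n; rewrite !inE -zeroP padic_poly_horner_int pdvd_int.
rewrite (card_set_has (P := fun a (n : 'I_(p ^ k)) => pdvd (L a) ((n : nat)%:Z%:~R - a))) //.
  rewrite !big_seq; apply: eq_bigr => a; rewrite alphaE => fa; apply: card_ball.
  by rewrite -/(L a) L_le // -[leqLHS]muln1 (leq_trans _ (leq_addl _ _)) // leq_mul ?mu_gt0.
move=> a b n; rewrite !alphaE => fa fb /(pdvd_le (j_le _ fa)) na /(pdvd_le (j_le _ fb)) nb.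
have ba : pdvd j (b - a).
  by rewrite -(addrNK ((n : nat)%:Z%:~R) b) -addrA pdvdD // -pdvdN opprB.
have [fE /(_ b ba)[F0 _]] := ball a fa.
move: (rootP fb); rewrite {1}fE hornerM horner_exp hornerXsubC => /eqP.
by rewrite mulf_eq0 (negPf F0) /= expf_eq0 => /andP[_]; rewrite subr_eq0 => /eqP.
Qed.

End Counting.

(** * The threshold *)

Lemma ceil_ball_exp (k v e : nat) : (0 < e)%N -> (v <= k)%N ->
  Num.ceil ((k%:Z - v%:Z)%:~R / e%:R : rat) = (ball_exp k v e)%:Z.
Proof.
move=> e0 vk; apply: ceil_def.
have e0' : 0 < e%:R :> rat by rewrite ltr0n.
rewrite ltr_pdivlMr // ler_pdivrMr // -[e%:R]/(e%:Z%:~R) -!intrM ltr_int ler_int.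
rewrite /ball_exp; have := divn_eq (k - v + e.-1) e; have := ltn_pmod (k - v + e.-1) e0.
by move: (_ %/ e)%N (_ %% e)%N => L m; nia.
Qed.

Lemma natr_exp_sub (F : fieldType) (x : F) (k L : nat) : (L <= k)%N ->
  x ^ (k%:Z - L%:Z) = x ^+ (k - L).
Proof. by move=> Lk; rewrite subzn. Qed.

Section Threshold.
Variables (p : nat) (p_pr : prime p).
Local Notation Zp := (padic_int p_pr).
Local Notation ev := (padic_poly p_pr).

Lemma padic_poly_neq0 (f : {poly int}) : f != 0 -> ev f != 0.
Proof.
move=> f0; apply/eqP => /(congr1 (fun P : {poly Zp} => P`_(size f).-1)).
rewrite coef_map coef0 => /eqP; rewrite intr_padic_eq0 -lead_coefE lead_coef_eq0.
exact/negP.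
Qed.

Definition zeros_are_balls (f : {poly int}) (alpha : seq Zp) (k : nat) :=
  [/\ forall a, root (ev f) a -> (root_nu f a <= k)%N,
      forall a, root (ev f) a ->
        ev f = root_cofactor f a * ('X - a%:P) ^+ \mu_a (ev f)
    & num_zeros p f k =
      (\sum_(a <- alpha) p ^ (k - ball_exp k (root_nu f a) (\mu_a (ev f))))%N].

(** For d = C = 1 the bound on the threshold is 0, so that the formula has to
    hold for every k, including k = 0; here f is X + b up to sign, and a single
    ball around its root, of radius 1, is everything. *)
Lemma linear_threshold (f : {poly int}) (alpha : seq Zp) (k : nat) :
    size f = 2 -> `|f`_1| = 1 ->
    uniq alpha -> (forall a, (a \in alpha) = root (ev f) a) ->
  zeros_are_balls f alpha k.
Proof.
move=> szf f1 ua alphaE; have f0 : f != 0 by rewrite -size_poly_gt0 szf.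
pose u : Zp := (f`_1)%:~R.
have f11 : f`_1 * f`_1 = 1 by rewrite -expr2 -real_normK ?num_real // f1 expr1n.
have uu : u * u = 1 by rewrite -intrM f11.
have u_unit : ~~ pdvd 1 u by rewrite -padic_unitE; apply/unitrP; exists u.
have u0 : u != 0 by apply: contraNneq u_unit => ->; rewrite pdvd0.
have fx x : (ev f).[x] = (f`_0)%:~R + u * x.
  rewrite (@horner_coef_wide _ 2); last by apply: leq_trans (size_poly _ _) _; rewrite szf.
  by rewrite !big_ord_recl big_ord0 /= !coef_map expr0 expr1 mulr1 addr0.
have fE a : root (ev f) a -> ev f = u%:P * ('X - a%:P) ^+ 1.
  move=> /rootP; rewrite fx => fa; apply/polyP => i.
  rewrite expr1 mulrBr -rmorphM coefB coefMX !coefC coef_map.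
  case: i => [|[|i]] /=; rewrite ?subr0 //.
    by rewrite sub0r; apply/eqP; rewrite -addr_eq0 fa.
  by rewrite nth_default ?szf.
have muE a : root (ev f) a -> \mu_a (ev f) = 1%N.
  by move=> fa; rewrite (fE a fa) cofactor_XsubC_mu // rootC.
have FE a : root (ev f) a -> root_cofactor f a = u%:P.
  move=> fa; rewrite /root_cofactor muE // (fE a fa).
  by rewrite Pdiv.IdomainMonic.mulpK // monic_exp // monicXsubC.
have vu : padic_val u = 0%N by apply: pdvd_val_uniq; rewrite ?pdvd0n.
have nuE a : root (ev f) a -> root_nu f a = 0%N.
  by move=> fa; rewrite /root_nu FE // hornerC.
split=> [a /nuE-> // | a fa | ]; first by rewrite muE // FE // -fE.
apply: (num_zeros_balls (j := 0)) => // [|x _|a fa].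
- exact: padic_poly_neq0.
- exists (- (f`_0)%:~R * u); last exact: pdvd0n.
  by apply/rootP; rewrite fx mulrCA uu mulr1 subrr.
- by rewrite nuE // FE // muE // -fE //; split=> // x _; rewrite hornerC.
Qed.

(** V and D are the valuations of the content and of the separation constant.
    Hensel's lemma needs k > V + 2 d D; then nu + mu D <= V + 2 d D < k too, so
    that the balls of zeros lie in the balls of radius p^(- D - 1) on which the
    cofactors are controlled. *)
Lemma threshold (f : {poly int}) (d C : nat) (alpha : seq Zp) :
    (0 < d)%N -> size f = d.+1 -> (forall i, `|f`_i| <= C%:Z) ->
    uniq alpha -> (forall a, (a \in alpha) = root (ev f) a) ->
  exists V D : nat, [/\ (p ^ V <= C)%N,
    (p ^ D <= d.*2 ^ d.*2 * (d * C) ^ d.*2)%N &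
    forall k, (V + d * D.*2 < k)%N -> zeros_are_balls f alpha k].
Proof.
move=> d0 szf fC ua alphaE; have f0 : f != 0 by rewrite -size_poly_gt0 szf.
have [c [s [r [fE [/andP[c0 cC] sd] /andP[r0 rB] sep]]]] := factor_separation d0 szf fC.
rewrite !absz_gt0 in c0 r0.
exists (logn p `|c|), (logn p `|r|).
have pl (m : int) : m != 0 -> (p ^ logn p `|m| <= `|m|)%N.
  by move=> m0; rewrite dvdn_leq ?absz_gt0 // pfactor_dvdnn.
split; [exact: leq_trans (pl _ c0) cC | exact: leq_trans (pl _ r0) rB|].
set V := logn p `|c|; set D := logn p `|r| => k ltk.
have sD : (size s * D <= d * D)%N by rewrite leq_mul2r sd orbT.
have ballE a (fa : root (ev f) a) := root_ball fE c0 r0 sep fa.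
have nu_le a : root (ev f) a -> (root_nu f a <= k)%N.
  by move=> /ballE[_ _ nu_le _]; move: ltk nu_le sD; rewrite -/V -/D -muln2; nia.
split=> // [a /ballE[] //|].
apply: (num_zeros_balls (j := D.+1)) => // [|x|a fa|a fa].
- exact: padic_poly_neq0.
- apply: (near_root fE c0 r0 sep); rewrite -/V -/D.
  by apply: leq_ltn_trans ltk; rewrite leq_add2l leq_mul2r sd orbT.
- by have [] := ballE a fa.
- have [_ /andP[e0 es] nu_leV _] := ballE a fa.
  rewrite ltnNge ball_exp_le // -ltnNge (leq_ltn_trans _ ltk) //.
  rewrite -/V -/D in nu_leV.
  have eD : (D * \mu_a (ev f) <= d * D)%N by rewrite mulnC leq_mul2r (leq_trans es) ?orbT.
  by move: nu_leV eD sD; rewrite -muln2; nia.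
Qed.

(** A multiple root is a zero of both f and f', hence of their resultant, an
    integer that is zero in Z_p only if it is zero. *)
Lemma discriminant_mu (f : {poly int}) a : (1 < size f)%N -> discriminant f != 0 ->
  root (ev f) a -> ev f = root_cofactor f a * ('X - a%:P) ^+ \mu_a (ev f) ->
  \mu_a (ev f) = 1%N.
Proof.
move=> szf disc fa fE; have f0 : f != 0 by rewrite -size_poly_gt0 ltnW.
apply/eqP; rewrite eqn_leq mu_gt0 ?padic_poly_neq0 // fa andbT leqNgt; apply/negP => mu2.
have f'a : (ev f^`()).[a] = 0.
  move: mu2 fE; case: (\mu_a (ev f)) => [|[|n]] // _ fE.
  rewrite /padic_poly -deriv_map -/(padic_poly p_pr f) fE derivM deriv_exp derivXsubC.
  by rewrite hornerD !hornerM hornerMn !hornerM !horner_exp hornerXsubC subrr !expr0n /=; ring.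
(* The resultant is a combination of f and f' only when f' is not constant. *)
have [f2 | f2] := leqP (size f^`()) 1.
  move: f'a; rewrite (size1_polyC f2) /padic_poly map_polyC hornerC => /eqP.
  rewrite intr_padic_eq0 => /eqP f10; move: (size_deriv f).
  by rewrite (size1_polyC f2) f10 size_poly0; move: szf; case: size => [|[]].
have [[u v] /= _ E] := resultant_in_ideal szf f2.
have : (resultant f f^`())%:~R = 0 :> Zp.
  have := congr1 (fun P => (ev P).[a]) E; rewrite /padic_poly map_polyC hornerC => ->.
  by rewrite rmorphD !rmorphM hornerD !hornerM f'a (rootP fa) !mulr0 addr0.
move/eqP; rewrite intr_padic_eq0 => /eqP res0; move: disc.
by rewrite /discriminant res0 div0z mulr0 eqxx.
Qed.

End Threshold.

(** Since p >= 2, V log 2 <= log C and D log 2 <= 2 d (log 2 + 2 log d + log C).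
    When d C >= 2, log 2 and the additional 1 are absorbed by log C + log d; the
    constant is 14 = 1 + 12 + 1. *)
Lemma threshold_bound (R : realType) (p d C V D : nat) :
    (1 < p)%N -> (0 < d)%N -> (1 < d * C)%N -> (p ^ V <= C)%N ->
    (p ^ D <= d.*2 ^ d.*2 * (d * C) ^ d.*2)%N ->
  (V + d * D.*2).+1%:R <= 14 / ln 2 * (d%:R ^+ 2 * (ln C%:R + ln d%:R)) :> R.
Proof.
move=> p1 d0 dC pV pD.
have C0 : (0 < C)%N by case: (C) dC => //; rewrite muln0.
have l2 : 0 < ln 2 :> R by rewrite ln_gt0 // ltr1n.
have le_ln m n : (0 < m)%N -> (m <= n)%N -> ln m%:R <= ln n%:R :> R.
  by move=> m0 mn; rewrite ler_ln ?posrE ?ltr0n ?ler_nat // (leq_trans m0).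
have pow2 n N : (p ^ n <= N)%N -> n%:R * ln 2 <= ln N%:R :> R.
  move=> pn; rewrite mulr_natl -lnXn ?ltr0n // -natrX le_ln ?expn_gt0 //.
  by apply: leq_trans pn; case: (n) => // n'; rewrite leq_exp2r.
have dR : 1 <= d%:R :> R by rewrite ler1n.
have d0R : 0 < d%:R :> R by rewrite ltr0n.
have C0R : 0 < C%:R :> R by rewrite ltr0n.
have hV := pow2 _ _ pV; have hD := pow2 _ _ pD.
have E : ln (d.*2 ^ d.*2 * (d * C) ^ d.*2)%N%:R =
    (2 * d%:R) * (ln 2 + 2 * ln d%:R + ln C%:R) :> R.
  have d2 : (0 < d.*2)%N by rewrite double_gt0.
  have dC0 : (0 < d * C)%N by rewrite muln_gt0 d0.
  have lnpow n m : (0 < n)%N -> ln (n ^ m)%N%:R = m%:R * ln n%:R :> R.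
    by move=> n0; rewrite natrX lnXn ?ltr0n // mulr_natl.
  rewrite natrM lnM ?posrE ?ltr0n ?expn_gt0 ?d2 ?dC0 // !lnpow // -muln2 !natrM.
  rewrite !lnM ?posrE ?ltr0n //.
  by ring.
rewrite E in hD.
have X2 : ln 2 <= ln C%:R + ln d%:R :> R.
  by rewrite addrC -lnM ?posrE // -natrM le_ln.
have lC : 0 <= ln C%:R :> R by rewrite ln_ge0 // ler1n.
have ld : 0 <= ln d%:R :> R by rewrite ln_ge0 // ler1n.
rewrite mulrAC ler_pdivlMr // -natr1 natrD natrM -muln2 natrM.
move: (ln 2) (ln C%:R) (ln d%:R) hV hD X2 lC ld l2 => l c e hV hD X2 lC ld l2.
have h1 : d%:R * (D%:R * l) <= d%:R * (2 * d%:R * (l + 2 * e + c)).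
  by rewrite ler_pM2l.
have h2 : d%:R * (2 * d%:R * (l + 2 * e + c)) <= d%:R ^+ 2 * (6 * (c + e)).
  have -> : d%:R * (2 * d%:R * (l + 2 * e + c)) = d%:R ^+ 2 * (2 * (l + 2 * e + c)) :> R.
    by ring.
  by rewrite ler_pM2l ?exprn_gt0 //; lra.
have h3 : c + e <= d%:R ^+ 2 * (c + e).
  by rewrite ler_peMl ?addr_ge0 // expr_ge1 // ltW.
have e2 : d%:R ^+ 2 * (6 * (c + e)) = 6 * (d%:R ^+ 2 * (c + e)) :> R by ring.
have -> : (V%:R + d%:R * (D%:R * 2) + 1) * l = V%:R * l + 2 * (d%:R * (D%:R * l)) + l :> R.
  by ring.
by rewrite e2 in h2; move: (d%:R ^+ 2 * (c + e)) h2 h3 => Y h2 h3; lra.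
Qed.

Theorem corollary2 (R : realType) :
  exists K : R,
  forall (d C p : nat) (p_pr : prime p) (f : {poly int})
    (alpha : seq (padic_int p_pr)),
  (0 < d)%N ->
  size f = d.+1 ->
  (forall i : nat, `|f`_i| <= C%:Z) ->
  uniq alpha ->
  (forall a : padic_int p_pr, (a \in alpha) = root (padic_poly p_pr f) a) ->
  exists k0 : nat,
  [/\ k0%:R <= K * (d%:R ^+ 2 * (ln C%:R + ln d%:R)),
      forall k : nat, (k0 <= k)%N ->
        (num_zeros p f k)%:R =
        \sum_(a <- alpha)
          p%:R ^ (k%:Z - Num.ceil ((k%:Z - (root_nu f a)%:Z)%:~R
                                   / (\mu_a (padic_poly p_pr f))%:R : rat))
        :> rat
    & discriminant f != 0 ->
        forall k : nat, (k0 <= k)%N -> num_zeros p f k = num_zeros p f k0].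
Proof.
exists (14 / ln 2) => d C p p_pr f alpha d0 szf fC ua alphaE.
have f0 : f != 0 by rewrite -size_poly_gt0 szf.
suff [k0 [k0_le balls]] : exists k0 : nat,
    k0%:R <= 14 / ln 2 * (d%:R ^+ 2 * (ln C%:R + ln d%:R)) :> R /\
    forall k, (k0 <= k)%N -> zeros_are_balls f alpha k.
  exists k0; split=> // [k /balls[nu_le fE ->] | disc k k0k].
    rewrite natr_sum !big_seq; apply: eq_bigr => a; rewrite alphaE => fa.
    have mu0 : (0 < \mu_a (padic_poly p_pr f))%N by rewrite mu_gt0 ?padic_poly_neq0.
    rewrite ceil_ball_exp ?nu_le // natr_exp_sub ?natrX //.
    by rewrite ball_exp_le // (leq_trans _ (leq_addl _ _)) // leq_pmulr.
  have const j : (k0 <= j)%N -> num_zeros p f j = (\sum_(a <- alpha) p ^ root_nu f a)%N.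
    move=> /balls[nu_le fE ->]; rewrite !big_seq; apply: eq_bigr => a.
    rewrite alphaE => fa; rewrite (discriminant_mu _ disc fa (fE a fa)) ?szf //.
    by rewrite /ball_exp addn0 divn1 subKn // nu_le.
  by rewrite !const.
have [dC | dC] := ltnP 1 (d * C).
  have [V [D [pV pD balls]]] := threshold d0 szf fC ua alphaE.
  exists (V + d * D.*2).+1; split=> //.
  by apply: threshold_bound pD => //; apply: prime_gt1.
have fd : f`_d != 0 by rewrite -[d]/(d.+1.-1) -szf -lead_coefE lead_coef_eq0.
have fd1 : 1 <= `|f`_d| by rewrite -gtz0_ge1 normr_gt0.
have C1 : (0 < C)%N by rewrite -lez_nat; apply: le_trans fd1 (fC d).
have [dE CE] : d = 1%N /\ C = 1%N by move: dC; nia.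
subst d C; exists 0%N; split=> [|k _]; first by rewrite ln1 addr0 !mulr0.
by apply: linear_threshold => //; apply/eqP; rewrite eq_le fC fd1.
Qed.
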